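(* Let $\beta>0$ and $\varepsilon\in(0,1]$. Let $\pi_0=\pi_{\mathrm{ref}}$ and, for $n\ge1$, let $\pi_n$ be the maximizer over all policies $\pi$ of the Mirror-GRPO objective (with $\alpha=0$) $$\mathbb{E}_{q\sim\rho_{\mathcal Q}}\Big(\mathbb{E}_{o\sim\pi(\cdot|q)}A_{n-1}(q,o)-\beta\,\mathsf{KL}\big(\pi(\cdot|q)\,\|\,\pi_{n-1}(\cdot|q)\big)\Big),$$ where $A_{n-1}(q,o)=\omega^+_\varepsilon(p_{n-1}(q))$ if $r(q,o)=1$, $A_{n-1}(q,o)=-\omega^-_\varepsilon(p_{n-1}(q))$ if $r(q,o)=0$, and $p_{n}(q)=\mathbb{P}_{o\sim\pi_{n}(\cdot|q)}(r(q,o)=1)$, $p_{\mathrm{ref}}(q)=p_0(q)$. Then, for $\rho_{\mathcal Q}$-almost every $q$: 1. (Monotone improvement, no interior fixed points) For every $n\ge1$, if $p_{n-1}(q)\in(0,1)$ then $\Omega_\varepsilon(p_{n-1}(q))/\beta>0$, $\mathrm{logit}(p_n(q))>\mathrm{logit}(p_{n-1}(q))$ and $p_n(q)>p_{n-1}(q)$. The equation $p=\sigma\big(\mathrm{logit}(p)+\Omega_\varepsilon(p)/\beta\big)$ has no solution in $(0,1)$; its only solutions in $[0,1]$ are $p=0$ and $p=1$. 2. (Convergence and stability) (a) If $p_{\mathrm{ref}}(q)\in(0,1)$, then $(p_n(q))_n$ is strictly increasing and bounded by $1$, and $p_n(q)\uparrow1$. (b) If $p_{\mathrm{ref}}(q)\in(0,1)$,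 then $p^*=1$ is a (globally) stable fixed point, in the sense that $\lim_{n\to\infty}p_n(q)=1$. (c) If $p_{\mathrm{ref}}(q)=0$, then $p_n(q)=0$ for all $n$.
   Context: $\rho_{\mathcal Q}$ is a probability distribution on the prompt space $\mathcal Q$; $\mathcal O$ is the outcome space with a fixed $\sigma$-finite base measure (counting measure when $\mathcal O$ is countable). A policy $\pi$ assigns (measurably) to each $q$ a probability density $\pi(\cdot|q)$ on $\mathcal O$. The reward $r:\mathcal Q\times\mathcal O\to\{0,1\}$ is measurable; $\pi_{\mathrm{ref}}$ is a fixed reference policy. $\mathsf{KL}$ is the Kullback–Leibler divergence, with values in $[0,\infty]$ (the objective is $-\infty$ when the expected divergence is infinite). $\omega^+_{\varepsilon}(p)=\frac{1-p}{\sqrt{p(1-p)+\varepsilon}}$, $\omega^-_{\varepsilon}(p)=\frac{p}{\sqrt{p(1-p)+\varepsilon}}$, $\Omega_\varepsilon(p)=\frac{1}{\sqrt{p(1-p)+\varepsilon}}$ for $p\in[0,1]$. $\mathrm{logit}(p)=\log\frac{p}{1-p}$ and $\sigma(x)=\frac1{1+e^{-x}}$, with the conventions $\mathrm{logit}(0)=-\infty$, $\mathrm{logit}(1)=+\infty$, $\sigma(-\infty)=0$, $\sigma(+\infty)=1$. *)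

(* Defs.v *)
From HB Require Import structures.
From mathcomp Require Export all_boot all_order all_algebra.
From mathcomp Require Export all_classical all_reals all_analysis.

Set Implicit Arguments.
Unset Strict Implicit.
Unset Printing Implicit Defensive.

Import Order.TTheory GRing.Theory Num.Theory.
Import numFieldNormedType.Exports.

Local Open Scope classical_set_scope.
Local Open Scope ring_scope.

Definition Omega (R : realType) (eps p : R) : R :=
  1 / Num.sqrt (p * (1 - p) + eps).

Definition omega_plus (R : realType) (eps p : R) : R :=
  (1 - p) / Num.sqrt (p * (1 - p) + eps).

Definition omega_minus (R : realType) (eps p : R) : R :=
  p / Num.sqrt (p * (1 - p) + eps).

(* Only meant for [0 <= p <= 1]. *)
Definition logit (R : realType) (p : R) : \bar R :=
  if p == 0 then -oo%E
  else if p == 1 then +oo%E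
  else (ln (p / (1 - p)))%:E.

Definition sigmoid (R : realType) (x : \bar R) : R :=
  match x with
  | r%:E => 1 / (1 + expR (- r))
  | +oo%E => 1
  | -oo%E => 0
  end.

Definition is_policy (dQ dO : measure_display) (Prompt : measurableType dQ)
    (Outcome : measurableType dO) (R : realType)
    (mu : {sigma_finite_measure set Outcome -> \bar R})
    (pi : Prompt -> Outcome -> R) : Prop :=
  [/\ measurable_fun [set: Prompt * Outcome] (fun x => pi x.1 x.2),
      forall q o, 0 <= pi q o
    & forall q, (\int[mu]_o (pi q o)%:E = 1)%E].

(* Integrand of the Kullback-Leibler divergence of the densities with values
   [a] and [b], with 0 * log (0 / b) = 0 and a * log (a / 0) = +oo for a > 0. *)
Definition KL_integrand (R : realType) (a b : R) : \bar R :=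
  if a == 0 then 0%E
  else if b == 0 then +oo%E
  else (a * ln (a / b))%:E.

(* For probability densities the negative part of the integrand is dominated
   by [g], so the integral is well defined; it is [+oo] when the first
   distribution is not absolutely continuous with respect to the second. *)
Definition KL (dO : measure_display) (Outcome : measurableType dO)
    (R : realType) (mu : {sigma_finite_measure set Outcome -> \bar R})
    (f g : Outcome -> R) : \bar R :=
  (\int[mu]_o KL_integrand (f o) (g o))%E.

Definition success_prob (dQ dO : measure_display) (Prompt : measurableType dQ)
    (Outcome : measurableType dO) (R : realType)
    (mu : {sigma_finite_measure set Outcome -> \bar R})
    (r : Prompt -> Outcome -> bool) (pi : Prompt -> Outcome -> R)
    (q : Prompt) : R :=
  \int[mu]_(o in [set o | r q o]) pi q o.

Definition advantage (dQ dO : measure_display) (Prompt : measurableType dQ)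
    (Outcome : measurableType dO) (R : realType)
    (mu : {sigma_finite_measure set Outcome -> \bar R})
    (r : Prompt -> Outcome -> bool) (eps : R)
    (pi_old : Prompt -> Outcome -> R) (q : Prompt) (o : Outcome) : R :=
  if r q o then omega_plus eps (success_prob mu r pi_old q)
  else - omega_minus eps (success_prob mu r pi_old q).

(* The advantage is bounded, so the inner expectation is finite and the outer
   integrand is bounded above: the outer integral is [-oo] exactly when the
   expected divergence is infinite. *)
Definition mirror_GRPO_objective (dQ dO : measure_display)
    (Prompt : measurableType dQ) (Outcome : measurableType dO) (R : realType)
    (rho : probability Prompt R)
    (mu : {sigma_finite_measure set Outcome -> \bar R})
    (r : Prompt -> Outcome -> bool) (beta eps : R)
    (pi_old pi : Prompt -> Outcome -> R) : \bar R :=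
  (\int[rho]_q
     (\int[mu]_o (advantage mu r eps pi_old q o * pi q o)%:E
      - beta%:E * KL mu (pi q) (pi_old q)))%E.

(* Maximizers are unique only up to null sets. *)
Definition is_mirror_GRPO_step (dQ dO : measure_display)
    (Prompt : measurableType dQ) (Outcome : measurableType dO) (R : realType)
    (rho : probability Prompt R)
    (mu : {sigma_finite_measure set Outcome -> \bar R})
    (r : Prompt -> Outcome -> bool) (beta eps : R)
    (pi_old pi_new : Prompt -> Outcome -> R) : Prop :=
  is_policy mu pi_new /\
  forall pi : Prompt -> Outcome -> R, is_policy mu pi ->
    (mirror_GRPO_objective rho mu r beta eps pi_old pi
     <= mirror_GRPO_objective rho mu r beta eps pi_old pi_new)%E.

(* Main.v *)
Require Import Defs.
Import Order.TTheory GRing.Theory Num.Theory.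
Import numFieldNormedType.Exports.
From mathcomp Require Import measurable_realfun ring lra.

(* By Gibbs' variational principle, for every prompt the inner objective equals
   beta * log Z(q) minus beta times the divergence of pi from the tilted policy
   pi_old * exp(A / beta) / Z. Both the tilted policy and the maximizer being
   measurable in q, the maximizer agrees with the tilt almost everywhere. As
   omega^+ + omega^- = Omega, the tilt multiplies the odds p / (1 - p) of
   success by exp(Omega(p) / beta) > 1; since Omega >= 1/2 on [0, 1], the odds
   grow geometrically. *)

Set Implicit Arguments.
Unset Strict Implicit.
Unset Printing Implicit Defensive.

Local Open Scope classical_set_scope.
Local Open Scope ring_scope.

(** * Additivity of integrals that may be infinite *)

(** Since [f] is nonnegative, the negative part of [f + g] is at most [|g|]. *)
Lemma integral_funeneg_addr_lty (d : measure_display) (T : measurableType d)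
    (R : realType) (mu : {measure set T -> \bar R}) (f : T -> \bar R)
    (g : T -> R) :
  measurable_fun [set: T] f -> (forall x, 0 <= f x)%E ->
  mu.-integrable [set: T] (EFin \o g) ->
  (\int[mu]_x (fun y => f y + (g y)%:E)^\- x < +oo)%E.
Proof.
move=> mf f0 ig.
have mg : measurable_fun [set: T] (EFin \o g) by exact: measurable_int ig.
have mh : measurable_fun [set: T] (fun x => f x + (g x)%:E)%E.
  exact: emeasurable_funD.
have /integrableP[_] := ig.
apply: le_lt_trans; apply: ge0_le_integral => //.
- exact: measurable_funeneg.
- exact: measurableT_comp.
- move=> x _; rewrite funenegE ge_max; apply/andP; split => //.
  rewrite fin_num_oppeD//=.
  apply: (@le_trans _ _ (- g x)%:E); last by rewrite lee_fin lerNl lerNnormlW.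
  by rewrite -[leRHS]add0e leeD2r// oppe_le0.
Qed.

(** The integral of [f] may be [+oo], as a divergence can be. In that case the negative part of
    [h = f + g] still has a finite integral, while its positive part cannot: otherwise [h], and with
    it [f = h - g], would be integrable. Hence both sides are [+oo]. *)
Lemma integralD_ge0_integrable (d : measure_display) (T : measurableType d)
    (R : realType) (mu : {measure set T -> \bar R}) (f : T -> \bar R)
    (g : T -> R) :
  measurable_fun [set: T] f -> (forall x, 0 <= f x)%E ->
  mu.-integrable [set: T] (EFin \o g) ->
  (\int[mu]_x (f x + (g x)%:E) = \int[mu]_x f x + \int[mu]_x (g x)%:E)%E.
Proof.
move=> mf f0 ig.
have [intf|nintf] := pselect (mu.-integrable [set: T] f).
  exact: integralD.
have mg : measurable_fun [set: T] (EFin \o g) by exact: measurable_int ig.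
pose h (x : T) : \bar R := (f x + (g x)%:E)%E; rewrite -[LHS]/(\int[mu]_x h x)%E.
have mh : measurable_fun [set: T] h by exact: emeasurable_funD.
have foo : (\int[mu]_x f x = +oo)%E.
  apply/eqP; rewrite -leye_eq leNgt; apply/negP => flt; apply: nintf.
  apply/integrableP; split => //.
  by under eq_integral do rewrite gee0_abs//.
have gfin : (\int[mu]_x (g x)%:E)%E \is a fin_num.
  exact: integrable_fin_num.
have hneg : (\int[mu]_x h^\- x < +oo)%E by exact: integral_funeneg_addr_lty.
have hpos : (\int[mu]_x h^\+ x = +oo)%E.
  apply/eqP; rewrite -leye_eq leNgt; apply/negP => hlt; apply: nintf.
  have inth : mu.-integrable [set: T] h.
    apply/integrableP; split => //.
    rewrite (eq_integral (fun x => h^\+ x + h^\- x)%E); last first.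
      by move=> x _; rewrite -/((abse \o h) x) fune_abse.
    rewrite ge0_integralD//.
    - exact: lte_add_pinfty.
    - exact: measurable_funepos.
    - exact: measurable_funeneg.
  have := integrableB measurableT inth ig.
  by apply: eq_integrable => // x _ /=; rewrite /h addeK.
rewrite foo [LHS]integralE hpos.
have hn : (- (\int[mu]_x h^\- x) != -oo)%E.
  by move: hneg; case: (\int[mu]_x h^\- x)%E.
by rewrite !addye//; move: gfin; rewrite fin_numE => /andP[].
Qed.

(** This is the shape of the objective: a finite reward term minus a divergence that may be
    infinite. It follows from the additive version by a change of sign. *)
Lemma integralB_integrable_ge0 (d : measure_display) (T : measurableType d)
    (R : realType) (mu : {measure set T -> \bar R}) (f : T -> \bar R)
    (g : T -> R) :
  measurable_fun [set: T] f -> (forall x, 0 <= f x)%E ->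
  mu.-integrable [set: T] (EFin \o g) ->
  (\int[mu]_x ((g x)%:E - f x) = \int[mu]_x (g x)%:E - \int[mu]_x f x)%E.
Proof.
move=> mf f0 ig.
have igN : mu.-integrable [set: T] (EFin \o (\- g)).
  by rewrite (_ : _ \o _ = -%E \o (EFin \o g))//; exact: integrableN.
rewrite (eq_integral (fun x => - (f x + (- g x)%:E))%E); last first.
  by move=> x _; rewrite oppeD ?fin_num_adde_defl// EFinN oppeK addeC.
rewrite integralN; last first.
  apply: fin_num_adde_defl; rewrite fin_numN ge0_fin_numE ?integral_ge0//.
  exact: integral_funeneg_addr_lty.
rewrite integralD_ge0_integrable// fin_num_oppeD; last exact: integrable_fin_num.
under [X in (_ - X)%E]eq_integral do rewrite EFinN.
rewrite integralN ?oppeK 1?addeC//; exact: integrable_add_def.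
Qed.

(** * The pointwise divergence integrand and its behaviour under tilting *)

Section gap.
Context {R : realType}.
Implicit Types a b c t : R.

(** This is the integrand [a * ln (a / c) - a + c] of the generalized divergence, the Bregman
    divergence of [x * ln x]. The added [c - a] integrates to 0 over two probability densities, and
    it makes the integrand nonnegative pointwise, which the integrand of [KL] is not. *)
Definition gap a c : \bar R := (KL_integrand a c + (c - a)%:E)%E.

(** This is the strict inequality [1 + x < expR x] at [x = ln (c / a)], multiplied by [a]. *)
Lemma gap_real_gt0 a c : 0 < a -> 0 < c -> a != c ->
  0 < a * ln (a / c) + (c - a).
Proof.
move=> a0 c0 ac.
have ca0 : 0 < c / a by rewrite divr_gt0.
have : 1 + ln (c / a) < c / a.
  rewrite -[ltRHS]lnK ?posrE//; apply: expR_gt1Dx.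
  rewrite ln_eq0//; apply: contra_neq ac => ca1.
  by rewrite -[RHS](divfK (lt0r_neq0 a0)) ca1 mul1r.
have -> : ln (c / a) = - ln (a / c) by rewrite -lnV ?posrE ?divr_gt0// invf_div.
rewrite ltr_pdivlMr// => H; lra.
Qed.

Lemma gapxx a : 0 <= a -> gap a a = 0%E.
Proof.
rewrite /gap /KL_integrand subrr adde0; case: eqVneq => // a0 _.
by rewrite divff// ln1 mulr0.
Qed.

Lemma gap_ge0 a c : 0 <= a -> 0 <= c -> (0 <= gap a c)%E.
Proof.
move=> a0 c0; have [->|ac] := eqVneq a c; first by rewrite gapxx.
rewrite /gap /KL_integrand; have [->|an0] := eqVneq a 0.
  by rewrite add0e subr0 lee_fin.
have [_|cn0] := eqVneq c 0; first by rewrite addye// leey.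
rewrite -EFinD lee_fin ltW// gap_real_gt0//.
- by rewrite lt0r an0.
- by rewrite lt0r cn0.
Qed.

Lemma gap_eq0 a c : 0 <= a -> 0 <= c -> gap a c = 0%E -> a = c.
Proof.
move=> a0 c0; rewrite /gap /KL_integrand; have [->|an0] := eqVneq a 0.
  by rewrite add0e subr0 => ca0; rewrite (EFin_inj ca0).
have [_|cn0] := eqVneq c 0; first by rewrite addye.
rewrite -EFinD => ca; have H := EFin_inj ca.
apply/eqP/negPn/negP => ac; have := @gap_real_gt0 a c.
by rewrite H ltxx !lt0r an0 cn0 a0 c0 => /(_ isT isT ac).
Qed.

(** Multiplying the second density by [expR t] lowers the log-ratio by [t], which contributes the
    term [a * t]. The correction is always finite, and [b] vanishes exactly when [b * expR t] does,
    so infinite values occur on both sides together. *)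
Lemma KL_integrand_tilt a b t : 0 <= a -> 0 <= b ->
  KL_integrand a b =
  (gap a (b * expR t) + (a - b * expR t + a * t)%:E)%E.
Proof.
rewrite /gap /KL_integrand !le0r => /predU1P[->|a0] b0.
  by rewrite eqxx add0e -EFinD; congr EFin; ring.
rewrite (gt_eqF a0) mulf_eq0 (gt_eqF (expR_gt0 t)) orbF.
case/predU1P: b0 => [->|b0]; first by rewrite eqxx !addye.
rewrite (gt_eqF b0) -!EFinD; congr EFin.
rewrite !ln_div ?posrE ?mulr_gt0 ?expR_gt0// lnM ?posrE ?expR_gt0// expRK.
by ring.
Qed.

Lemma measurable_KL_integrand (d : measure_display) (T : measurableType d)
    (f g : T -> R) :
  measurable_fun [set: T] f -> measurable_fun [set: T] g ->
  (forall x, 0 <= f x) -> (forall x, 0 <= g x) ->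
  measurable_fun [set: T] (fun x => KL_integrand (f x) (g x)).
Proof.
move=> mf mg f0 g0.
rewrite (_ : (fun x => _) = fun x => if f x == 0 then 0%E else
   if g x == 0 then +oo%E else (f x * (ln (f x) - ln (g x)))%:E); last first.
  apply/funext => x; rewrite /KL_integrand.
  case: eqVneq => // fx0; case: eqVneq => // gx0.
  by rewrite ln_div ?posrE ?lt0r ?fx0 ?gx0 ?f0 ?g0.
apply: measurable_fun_ifT => //.
  exact: (measurable_fun_eqr mf (@measurable_cst _ _ T R setT 0)).
apply: measurable_fun_ifT => //.
  exact: (measurable_fun_eqr mg (@measurable_cst _ _ T R setT 0)).
apply/measurable_EFinP; apply: measurable_funM => //.
by apply: measurable_funB; apply: measurableT_comp => //; exact: measurable_ln.
Qed.

Lemma measurable_gap (d : measure_display) (T : measurableType d)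
    (f g : T -> R) :
  measurable_fun [set: T] f -> measurable_fun [set: T] g ->
  (forall x, 0 <= f x) -> (forall x, 0 <= g x) ->
  measurable_fun [set: T] (fun x => gap (f x) (g x)).
Proof.
move=> mf mg f0 g0; apply: emeasurable_funD.
  exact: measurable_KL_integrand.
by apply/measurable_EFinP; exact: measurable_funB.
Qed.

End gap.

(** * Gibbs' variational principle at a fixed prompt *)

Lemma density_integrable (d : measure_display) (T : measurableType d)
    (R : realType) (mu : {measure set T -> \bar R}) (f : T -> R) :
  measurable_fun [set: T] f -> (forall x, 0 <= f x) ->
  (\int[mu]_x (f x)%:E = 1)%E -> mu.-integrable [set: T] (EFin \o f).
Proof.
move=> mf f0 f1; apply/integrableP; split; first exact/measurable_EFinP.
under eq_integral do rewrite /= ger0_norm//.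
by rewrite f1 ltry.
Qed.

Lemma bounded_density_integrable (d : measure_display) (T : measurableType d)
    (R : realType) (mu : {measure set T -> \bar R}) (f A : T -> R) (M : R) :
  measurable_fun [set: T] f -> (forall x, 0 <= f x) ->
  (\int[mu]_x (f x)%:E = 1)%E ->
  measurable_fun [set: T] A -> (forall x, `|A x| <= M) ->
  mu.-integrable [set: T] (fun x => (A x * f x)%:E).
Proof.
move=> mf f0 f1 mA AM.
apply: (@le_integrable _ _ _ mu setT measurableT _ (fun x => M%:E * (f x)%:E)%E).
- by apply/measurable_EFinP; exact: measurable_funM.
- move=> x _; rewrite -EFinM !abse_EFin lee_fin !normrM ler_wpM2r//.
  by rewrite (le_trans (AM x)) ?ler_norm.
- exact/integrableZl/density_integrable.
Qed.

(** Here [l] is the log-partition function, characterized by the tilted density having mass 1.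
    Integrating [KL_integrand_tilt] with [t = A x / beta - l] makes the reward term cancel and
    leaves [beta * l] minus a nonnegative defect. *)
Lemma gibbs_variational (d : measure_display) (T : measurableType d)
    (R : realType) (mu : {sigma_finite_measure set T -> \bar R})
    (f b A : T -> R) (M beta l : R) :
  0 < beta ->
  measurable_fun [set: T] f -> (forall x, 0 <= f x) ->
  (\int[mu]_x (f x)%:E = 1)%E ->
  measurable_fun [set: T] b -> (forall x, 0 <= b x) ->
  measurable_fun [set: T] A -> (forall x, `|A x| <= M) ->
  (\int[mu]_x (b x * expR (A x / beta - l))%:E = 1)%E ->
  (\int[mu]_x (A x * f x)%:E - beta%:E * KL mu f b =
   (beta * l)%:E -
   beta%:E * \int[mu]_x gap (f x) (b x * expR (A x / beta - l)))%E.
Proof.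
move=> beta0 mf f0 f1 mb b0 mA AM c1.
set c := fun x => b x * expR (A x / beta - l).
have c0 x : 0 <= c x by rewrite mulr_ge0// expR_ge0.
have mc : measurable_fun [set: T] c.
  apply: measurable_funM => //; apply: (measurableT_comp (@measurable_expR R)).
  by apply: measurable_funB => //; exact: measurable_funM.
have intf := density_integrable mf f0 f1.
have intc := density_integrable mc c0 c1.
have intAf := bounded_density_integrable mf f0 f1 mA AM.
have Afin : (\int[mu]_x (A x * f x)%:E)%E \is a fin_num.
  exact: integrable_fin_num.
set G := (\int[mu]_x gap (f x) (c x))%E.
have G0 : (0 <= G)%E by apply: integral_ge0 => x _; exact: gap_ge0.
have -> : (KL mu f b =
    G + (beta^-1%:E * \int[mu]_x (A x * f x)%:E - l%:E))%E.
  rewrite /KL.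
  (* The finite correction splits into [f - c], whose integral is 0, and the tilt exponent weighted
     by [f]. *)
  pose g x := (f x - c x) + (beta^-1 * (A x * f x) - l * f x).
  rewrite (eq_integral (fun x => (gap (f x) (c x) + (g x)%:E)%E)); last first.
    move=> x _; rewrite (@KL_integrand_tilt _ _ _ (A x / beta - l))//.
    by congr (_ + _%:E)%E; rewrite /g /c; ring.
  have int1 : mu.-integrable [set: T]
      (fun x => (EFin \o f) x - (EFin \o c) x)%E by exact: integrableB.
  have int2 : mu.-integrable [set: T]
      (fun x => beta^-1%:E * (A x * f x)%:E)%E by exact: integrableZl.
  have int3 : mu.-integrable [set: T] (fun x => l%:E * (EFin \o f) x)%E.
    exact: integrableZl.
  have int4 : mu.-integrable [set: T]
      (fun x => beta^-1%:E * (A x * f x)%:E - l%:E * (EFin \o f) x)%E.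
    exact: integrableB.
  have gE : EFin \o g = (fun x => ((EFin \o f) x - (EFin \o c) x) +
      (beta^-1%:E * (A x * f x)%:E - l%:E * (EFin \o f) x))%E.
    by apply/funext => x /=; rewrite /g !EFinD !EFinN !EFinM.
  have intg : mu.-integrable [set: T] (EFin \o g).
    by rewrite gE; exact: integrableD.
  rewrite integralD_ge0_integrable//; last first.
  - by move=> x; exact: gap_ge0.
  - exact: measurable_gap.
  congr (_ + _)%E.
  rewrite -[LHS]/(\int[mu]_x (EFin \o g) x)%E gE integralD//.
  rewrite integralB// f1 c1 subee// add0e integralB// !integralZl//.
  by rewrite f1 mule1.
(* Only [G] can still be infinite, and then both sides are [-oo]. *)
move: Afin; case: (\int[mu]_x (A x * f x)%:E)%E => // a _.
move: G0; case: G => [G| |]// _.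
- rewrite -!(EFinM, EFinN, EFinD); congr EFin.
  by field; rewrite gt_eqF.
- by rewrite -[(_ * a%:E)%E]EFinM -EFinB addye// gt0_muley ?lte_fin// !addeNy.
Qed.

(** * From maximality on average to the tilted policy almost everywhere *)

Lemma section_measurable (d1 d2 d3 : measure_display) (T1 : measurableType d1)
    (T2 : measurableType d2) (U : measurableType d3) (f : T1 -> T2 -> U)
    (x : T1) :
  measurable_fun [set: T1 * T2] (fun y => f y.1 y.2) ->
  measurable_fun [set: T2] (f x).
Proof. by move=> mf; apply: (measurableT_comp mf (pair1_measurable x)). Qed.

(** The tilt [c] is itself an admissible policy with zero defect, so a maximizer must have zero
    expected defect. The bound on [l] makes the constant term finite, so that it can be cancelled;
    Tonelli's theorem makes the defect measurable in the prompt. *)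
Lemma maximizer_ae_tilt (d1 d2 : measure_display) (T1 : measurableType d1)
    (T2 : measurableType d2) (R : realType) (rho : probability T1 R)
    (mu : {sigma_finite_measure set T2 -> \bar R})
    (A b f : T1 -> T2 -> R) (l : T1 -> R) (M L beta : R) :
  0 < beta ->
  measurable_fun [set: T1 * T2] (fun x => A x.1 x.2) ->
  (forall q o, `|A q o| <= M) ->
  measurable_fun [set: T1] l -> (forall q, `|l q| <= L) ->
  is_policy mu b ->
  (forall q, \int[mu]_o (b q o * expR (A q o / beta - l q))%:E = 1)%E ->
  is_policy mu f ->
  (forall g : T1 -> T2 -> R, is_policy mu g ->
    \int[rho]_q (\int[mu]_o (A q o * g q o)%:E - beta%:E * KL mu (g q) (b q))
    <= \int[rho]_q (\int[mu]_o (A q o * f q o)%:E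
                    - beta%:E * KL mu (f q) (b q)))%E ->
  {ae rho, forall q, {ae mu, forall o,
    f q o = b q o * expR (A q o / beta - l q)}}.
Proof.
move=> beta0 mA AM ml lL [mb b0 b1] c1 fpol fmax.
pose c q o := b q o * expR (A q o / beta - l q).
have c0 q o : 0 <= c q o by rewrite mulr_ge0// expR_ge0.
have mc : measurable_fun [set: T1 * T2] (fun x => c x.1 x.2).
  apply: measurable_funM => //; apply: (measurableT_comp (@measurable_expR R)).
  apply: measurable_funB; first exact: measurable_funM.
  exact: (measurableT_comp ml).
have cpol : is_policy mu c by split.
have mgap (g : T1 -> T2 -> R) : is_policy mu g ->
    measurable_fun [set: T1 * T2] (fun x => gap (g x.1 x.2) (c x.1 x.2)).
  by case=> mg g0 _; exact: measurable_gap.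
pose K (g : T1 -> T2 -> R) q : \bar R := (\int[mu]_o gap (g q o) (c q o))%E.
have K0 g q : is_policy mu g -> (0 <= K g q)%E.
  by case=> _ g0 _; apply: integral_ge0 => o _; exact: gap_ge0.
have mK g : is_policy mu g -> measurable_fun [set: T1] (K g).
  move=> gpol.
  apply: (@measurable_fun_fubini_tonelli_F _ _ _ _ _ mu
            (fun x => gap (g x.1 x.2) (c x.1 x.2))).
    exact: mgap.
  by move=> x; case: gpol => _ g0 _; exact: gap_ge0.
have il : rho.-integrable [set: T1] (EFin \o (fun q => beta * l q)).
  apply: (@le_integrable _ _ _ rho setT measurableT _ (EFin \o cst (beta * L))).
  - by apply/measurable_EFinP; exact: measurable_funM.
  - move=> q _ /=; rewrite lee_fin !normrM ler_wpM2l//.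
    by rewrite (le_trans (lL q)) ?ler_norm.
  - exact: finite_measure_integrable_cst.
(* The first term of the resulting formula does not depend on the policy. *)
have JE g : is_policy mu g ->
    (\int[rho]_q (\int[mu]_o (A q o * g q o)%:E - beta%:E * KL mu (g q) (b q))
     = \int[rho]_q (beta * l q)%:E - beta%:E * \int[rho]_q K g q)%E.
  move=> gpol; have [mg g0 g1] := gpol.
  rewrite (eq_integral (fun q => (beta * l q)%:E - beta%:E * K g q)%E).
    rewrite integralB_integrable_ge0//.
    - by rewrite ge0_integralZl// ?lee_fin ?(ltW beta0)//; [exact: mK|
        move=> q _; exact: K0].
    - by apply: measurable_funeM; exact: mK.
    - by move=> q; rewrite mule_ge0 ?lee_fin ?(ltW beta0)// K0.
  move=> q _; apply: (@gibbs_variational _ _ _ _ _ _ _ M) => //.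
  - exact: section_measurable mg.
  - exact: section_measurable mb.
  - exact: section_measurable mA.
have Kc q : K c q = 0%E.
  by apply: integral0_eq => o _; rewrite gapxx.
(* Comparison with the competitor [c], whose defect [K c] vanishes. *)
have := fmax c cpol; rewrite !JE//.
rewrite [X in (_ - _ * X <= _)%E]integral0_eq// mule0 sube0.
have : (0 <= \int[rho]_q K f q)%E by apply: integral_ge0 => q _; exact: K0.
have := integrable_fin_num measurableT il.
rewrite /comp; case: (\int[rho]_q (beta * l q)%:E)%E => // v _.
move=> K0' vle.
(* The constant [v] is finite: a positive defect would put the maximizer strictly below [v], an
   infinite one at [-oo]. *)
have Kf0 : (\int[rho]_q K f q = 0)%E.
  move: K0' vle; case: (\int[rho]_q K f q)%E => [k| |]//.
  - rewrite -EFinM -EFinB !lee_fin => k0 vle; congr EFin.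
    apply/eqP; rewrite eq_le k0 andbT -(pmulr_rle0 _ beta0); lra.
  - by rewrite gt0_muley ?lte_fin// addeNy leeNy_eq.
(* A nonnegative function with zero integral vanishes almost everywhere. This is applied over
   prompts first, then over outcomes to the gap itself. *)
have /ae_eq_integral_abs : (\int[rho]_q `|K f q| = 0)%E.
  by under eq_integral do rewrite gee0_abs ?K0//.
move=> /(_ measurableT (mK _ fpol)); apply: filterS => q /= /(_ I) Kq0.
have [mf f0 f1] := fpol.
have mgq : measurable_fun [set: T2] (fun o => gap (f q o) (c q o)).
  by apply: measurable_gap => //;
    [exact: section_measurable mf|exact: section_measurable mc].
have /ae_eq_integral_abs : (\int[mu]_o `|gap (f q o) (c q o)| = 0)%E.
  by rewrite -Kq0; apply: eq_integral => o _; rewrite gee0_abs ?gap_ge0.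
move=> /(_ measurableT mgq); apply: filterS => o /= /(_ I).
exact: gap_eq0.
Qed.

(** * The scalar recursion for the success probability *)

Section dynamics.
Context {R : realType}.
Variables (eps beta : R).
Hypotheses (eps_gt0 : 0 < eps) (beta_gt0 : 0 < beta).

(** This map multiplies the odds [p / (1 - p)] by [expR (Omega eps p / beta)]. Written as a fraction
    it avoids [logit], and it makes sense at [p = 0] and [p = 1] as well. *)
Definition success_step (p : R) : R :=
  p * expR (Omega eps p / beta) / (p * expR (Omega eps p / beta) + (1 - p)).

Lemma variance_ge0 (p : R) : 0 <= p <= 1 -> 0 <= p * (1 - p).
Proof. by case/andP => p0 p1; rewrite mulr_ge0 ?subr_ge0. Qed.

Lemma Omega_gt0 (p : R) : 0 <= p <= 1 -> 0 < Omega eps p.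
Proof.
move=> p01; rewrite /Omega div1r invr_gt0 sqrtr_gt0.
by rewrite ltr_wpDl// variance_ge0.
Qed.

Lemma Omega_le (p : R) : 0 <= p <= 1 -> Omega eps p <= (Num.sqrt eps)^-1.
Proof.
move=> p01; have v0 := variance_ge0 p01.
rewrite /Omega div1r lef_pV2 ?posrE ?sqrtr_gt0//; last by rewrite ltr_wpDl.
by rewrite ler_wsqrtr// lerDr.
Qed.

(** A crude estimate suffices: [p * (1 - p) + eps] is at most [4 = 2 ^+ 2]. What matters is that the
    bound is uniform in [p]. *)
Lemma Omega_ge (p : R) : eps <= 1 -> 0 <= p <= 1 -> 2^-1 <= Omega eps p.
Proof.
move=> eps1 p01; have v0 := variance_ge0 p01.
rewrite /Omega div1r lef_pV2 ?posrE ?sqrtr_gt0//; last by rewrite ltr_wpDl.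
have -> : (2 : R) = Num.sqrt (2 ^+ 2) by rewrite sqrtr_sqr ger0_norm.
rewrite ler_wsqrtr//; case/andP: p01 => p0 p1; nra.
Qed.

Lemma expR_Omega_gt1 (p : R) : 0 <= p <= 1 -> 1 < expR (Omega eps p / beta).
Proof. by move=> p01; rewrite -expR0 ltr_expR divr_gt0// Omega_gt0. Qed.

Lemma success_step0 : success_step 0 = 0.
Proof. by rewrite /success_step !mul0r. Qed.

Lemma success_step_in (p : R) : 0 < p < 1 -> p < success_step p < 1.
Proof.
case/andP => p0 p1.
have : 1 < expR (Omega eps p / beta) by rewrite expR_Omega_gt1 ?ltW.
rewrite /success_step; move: (expR _) => E E1.
have E0 : 0 < E by exact: lt_trans E1.
have D0 : 0 < p * E + (1 - p) by rewrite addr_gt0 ?mulr_gt0 ?subr_gt0.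
rewrite ltr_pdivlMr// ltr_pdivrMr//; apply/andP; split; last lra.
rewrite ltr_pM2l// -subr_gt0.
rewrite (_ : _ - _ = (E - 1) * (1 - p)); last by ring.
by rewrite mulr_gt0 ?subr_gt0.
Qed.

(** Inverse odds are tracked because they contract multiplicatively and dominate [1 - p]. *)
Lemma odds_success_step (p : R) : 0 < p < 1 ->
  (1 - success_step p) / success_step p =
  expR (- (Omega eps p / beta)) * ((1 - p) / p).
Proof.
case/andP => p0 p1.
have E0 := expR_gt0 (Omega eps p / beta).
rewrite /success_step expRN; move: (expR _) E0 => E E0.
have D0 : 0 < p * E + (1 - p) by rewrite addr_gt0 ?mulr_gt0 ?subr_gt0.
by field; rewrite !gt_eqF.
Qed.

(** This ties the [logit] form of the fixed-point equation to the rational map that the policies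
    follow. *)
Lemma sigmoid_logit_step (p : R) : 0 < p < 1 ->
  sigmoid (logit p + (Omega eps p / beta)%:E)%E = success_step p.
Proof.
case/andP => p0 p1.
rewrite /logit (gt_eqF p0) (lt_eqF p1) -EFinD /sigmoid opprD expRD expRN.
rewrite lnK ?posrE ?divr_gt0 ?subr_gt0// /success_step expRN.
have E0 := expR_gt0 (Omega eps p / beta); move: (expR _) E0 => E E0.
have D0 : 0 < p * E + (1 - p) by rewrite addr_gt0 ?mulr_gt0 ?subr_gt0.
by field; rewrite !gt_eqF ?subr_gt0.
Qed.

Lemma sigmoid_logit_fixed0 :
  sigmoid (logit 0 + (Omega eps 0 / beta)%:E)%E = 0.
Proof. by rewrite /logit eqxx addNye. Qed.

Lemma sigmoid_logit_fixed1 :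
  sigmoid (logit 1 + (Omega eps 1 / beta)%:E)%E = 1.
Proof. by rewrite /logit eqxx oner_eq0 addye. Qed.

Lemma logit_lt (p p' : R) : 0 < p -> p < p' -> p' < 1 ->
  (logit p < logit p')%E.
Proof.
move=> p0 pp p1; have p'0 := lt_trans p0 pp; have p1' := lt_trans pp p1.
rewrite /logit (gt_eqF p0) (gt_eqF p'0) (lt_eqF p1) (lt_eqF p1') lte_fin.
rewrite ltr_ln ?posrE ?divr_gt0 ?subr_gt0//.
by rewrite ltr_pdivrMr ?subr_gt0// mulrAC ltr_pdivlMr ?subr_gt0//; nra.
Qed.

Lemma no_interior_fixed_point (p : R) : 0 < p < 1 ->
  p <> sigmoid (logit p + (Omega eps p / beta)%:E)%E.
Proof.
move=> p01; rewrite sigmoid_logit_step// => pE.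
by have := success_step_in p01; rewrite -pE ltxx.
Qed.

Section orbit.
Variable x : nat -> R.
Hypothesis xS : forall n, x n.+1 = success_step (x n).

Lemma orbit0 : x 0 = 0 -> forall n, x n = 0.
Proof. by move=> x0; elim=> // n IH; rewrite xS IH success_step0. Qed.

Hypothesis x01 : 0 < x 0 < 1.

Lemma orbit_in n : 0 < x n < 1.
Proof.
elim: n => // n IH; rewrite xS; have /andP[lt ->] := success_step_in IH.
by case/andP: IH => x0 _; rewrite (lt_trans x0 lt).
Qed.

Lemma orbit_lt m n : (m < n)%N -> x m < x n.
Proof.
elim: n => // n IH; have /andP[lt _] := success_step_in (orbit_in n).
rewrite ltnS leq_eqVlt => /predU1P[->|/IH mn]; rewrite xS//.
exact: lt_trans lt.
Qed.

Hypothesis eps_le1 : eps <= 1.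

(* The inverse odds shrink by a factor expR (- Omega / beta), which is bounded
   away from 1 because Omega >= 1/2 on [0, 1]. *)
Lemma orbit_gap n :
  1 - x n <= expR (- (2^-1 / beta)) ^+ n * ((1 - x 0) / x 0).
Proof.
(* Dividing by [x n], which is at most 1, passes to the inverse odds, for which the induction
   closes. *)
apply: (@le_trans _ _ ((1 - x n) / x n)).
  have /andP[x0 x1] := orbit_in n.
  by rewrite ler_pdivlMr// ler_piMr ?subr_ge0 ?ltW.
elim: n => [|n IH]; first by rewrite mul1r.
have xin := orbit_in n; have /andP[x0 x1] := xin.
rewrite xS odds_success_step// exprS -mulrA ler_pM ?expR_ge0//.
  by rewrite divr_ge0 ?subr_ge0 ?ltW.
rewrite ler_expR lerN2 ler_wpM2r ?invr_ge0 ?(ltW beta_gt0)//.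
by rewrite Omega_ge// !ltW.
Qed.

Lemma orbit_cvg1 : x n @[n --> \oo] --> (1 : R).
Proof.
set k := expR (- (2^-1 / beta)).
have k1 : `|k| < 1.
  by rewrite ger0_norm ?expR_ge0// expR_lt1 oppr_lt0 divr_gt0.
(* The lower barrier of a squeeze whose upper barrier is the constant 1. *)
have gcvg : 1 - k ^+ n * ((1 - x 0) / x 0) @[n --> \oo] --> (1 : R).
  rewrite -[X in _ --> X]subr0; apply: cvgB; first exact: cvg_cst.
  rewrite -[X in _ --> X](mul0r ((1 - x 0) / x 0)).
  by apply: cvgMl; exact: cvg_expr.
apply: squeeze_cvgr gcvg (@cvg_cst _ (1 : R) _ _ _).
near=> n; have /andP[_ x1] := orbit_in n.
by rewrite (ltW x1) andbT lerBlDl -lerBlDr orbit_gap.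
Unshelve. all: by end_near. Qed.

End orbit.
End dynamics.

(** * The success probability after one policy step *)

(** The advantage, and hence the tilt, takes one value on successes and one on failures, so
    integrals against the policy reduce to the success probability. *)
Lemma two_valued_integral (d : measure_display) (T : measurableType d)
    (R : realType) (mu : {measure set T -> \bar R}) (f : T -> R) (S : T -> bool)
    (u v : R) :
  measurable_fun [set: T] f -> (forall x, 0 <= f x) ->
  (\int[mu]_x (f x)%:E = 1)%E -> measurable_fun [set: T] S ->
  0 <= u -> 0 <= v ->
  let p := \int[mu]_(x in [set x | S x]) f x in
  0 <= p <= 1 /\
  (\int[mu]_x (f x * (if S x then u else v))%:E = (p * u + (1 - p) * v)%:E)%E.
Proof.
move=> mf f0 f1 mS u0 v0 p.
have mES : measurable [set x | S x].
  by rewrite -[X in measurable X]setTI; exact: mS.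
have mEN : measurable (~` [set x | S x]) by exact: measurableC.
have mE (D : set T) : measurable_fun D (fun x => (f x)%:E).
  by apply/measurable_EFinP; exact: measurable_funS mf.
have mg (D : set T) : measurable_fun D (fun x => (f x * (if S x then u else v))%:E).
  apply/measurable_EFinP; apply: (measurable_funS measurableT) => //.
  by apply: measurable_funM => //; exact: measurable_fun_ifT.
have splitT (g : T -> \bar R) : measurable_fun [set: T] g ->
    (forall x, 0 <= g x)%E ->
    (\int[mu]_x g x = \int[mu]_(x in [set x | S x]) g x +
      \int[mu]_(x in ~` [set x | S x]) g x)%E.
  move=> mg' g0; rewrite -ge0_integral_setU//.
  - by rewrite setUCr.
  - by rewrite setUCr.
  - exact/disj_setPCl.
have sum1 := splitT _ (mE setT) (fun x => f0 x).
rewrite f1 in sum1.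
have P0 : (0 <= \int[mu]_(x in [set x | S x]) (f x)%:E)%E.
  by apply: integral_ge0 => x _; rewrite lee_fin.
have N0 : (0 <= \int[mu]_(x in ~` [set x | S x]) (f x)%:E)%E.
  by apply: integral_ge0 => x _; rewrite lee_fin.
(* The real-valued integral is [fine] of the extended one. The two nonnegative pieces add up to 1,
   so neither is infinite and [fine] loses nothing. *)
have [pE NE] : (\int[mu]_(x in [set x | S x]) (f x)%:E = p%:E)%E /\
    (\int[mu]_(x in ~` [set x | S x]) (f x)%:E = (1 - p)%:E)%E.
  rewrite /p /Rintegral; move: P0 N0 sum1.
  case: (\int[mu]_(x in [set x | S x]) (f x)%:E)%E => [a| |]//;
    case: (\int[mu]_(x in ~` [set x | S x]) (f x)%:E)%E => [b| |]// _ _.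
  rewrite -EFinD /= => -[->]; split => //; congr EFin; ring.
split.
  by move: P0 N0; rewrite pE NE !lee_fin => -> /=; rewrite subr_ge0.
rewrite splitT//; last first.
  by move=> x; rewrite lee_fin mulr_ge0//; case: ifP.
rewrite EFinD; congr (_ + _)%E.
- rewrite (eq_integral (fun x => (f x)%:E * u%:E)%E); last first.
    by move=> x; rewrite inE /= => ->.
  by rewrite ge0_integralZr// ?pE// => x _; rewrite lee_fin.
- rewrite (eq_integral (fun x => (f x)%:E * v%:E)%E); last first.
    by move=> x; rewrite inE /= => /negP/negbTE ->.
  by rewrite ge0_integralZr// ?NE// => x _; rewrite lee_fin.
Qed.

Section step.
Context (R : realType) (dQ dO : measure_display) (Prompt : measurableType dQ)
  (Outcome : measurableType dO) (rho : probability Prompt R)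
  (mu : {sigma_finite_measure set Outcome -> \bar R})
  (r : Prompt -> Outcome -> bool).
Hypothesis r_meas : measurable_fun [set: Prompt * Outcome] (fun x => r x.1 x.2).
Variables (beta eps : R).
Hypotheses (beta_gt0 : 0 < beta) (eps_gt0 : 0 < eps).
Variable b : Prompt -> Outcome -> R.
Hypothesis b_policy : is_policy mu b.

Let p := success_prob mu r b.

Lemma policy_two_valued_integral q (u v : R) : 0 <= u -> 0 <= v ->
  0 <= p q <= 1 /\
  (\int[mu]_o (b q o * (if r q o then u else v))%:E =
   (p q * u + (1 - p q) * v)%:E)%E.
Proof.
case: b_policy => mb b0 b1 u0 v0; apply: two_valued_integral => //.
- exact: section_measurable mb.
- exact: section_measurable r_meas.
Qed.

Lemma success_prob_in q : 0 <= p q <= 1.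
Proof. by case: (@policy_two_valued_integral q 0 0). Qed.

(** The domain of integration in [success_prob] varies with the prompt. Moving the success event
    into the integrand gives a nonnegative jointly measurable function over a fixed domain, to which
    Tonelli's theorem applies. *)
Lemma measurable_success_prob : measurable_fun [set: Prompt] p.
Proof.
case: b_policy => mb b0 _.
have -> : p = fine \o (fun q => \int[mu]_o (b q o * (if r q o then 1 else 0))%:E)%E.
  apply/funext => q /=; have [_ ->] := policy_two_valued_integral q ler01 (lexx 0).
  by rewrite /= mulr1 mulr0 addr0.
apply: measurableT_comp; first exact: fine_measurable.
apply: (@measurable_fun_fubini_tonelli_F _ _ _ _ _ mu
  (fun x => (b x.1 x.2 * (if r x.1 x.2 then 1 else 0))%:E)).
- apply/measurable_EFinP; apply: measurable_funM => //.
  exact: measurable_fun_ifT.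
- by move=> x; rewrite lee_fin mulr_ge0//; case: ifP.
Qed.

Let Om q := Omega eps (p q).
Let wp q := omega_plus eps (p q).
Let wm q := omega_minus eps (p q).

Let wpE q : wp q = (1 - p q) * Om q.
Proof. by rewrite /wp /Om /omega_plus /Omega div1r. Qed.

Let wmE q : wm q = p q * Om q.
Proof. by rewrite /wm /Om /omega_minus /Omega div1r. Qed.

Let measurable_Om : measurable_fun [set: Prompt] Om.
Proof.
(* The reciprocal is written as a power, a measurable function; the two agree because the square
   root is nonnegative. *)
have -> : Om = (@powR R ^~ (-1)) \o (@Num.sqrt R) \o
    (fun q => p q * (1 - p q) + eps).
  by apply/funext => q /=; rewrite powR_inv1 ?sqrtr_ge0// /Om /Omega div1r.
apply: measurableT_comp.
  apply: measurableT_comp; first exact: measurable_powR.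
  apply: continuous_measurable_fun; exact: sqrt_continuous.
apply: measurable_funD => //; apply: measurable_funM.
  exact: measurable_success_prob.
by apply: measurable_funB => //; exact: measurable_success_prob.
Qed.

Let measurable_wp : measurable_fun [set: Prompt] wp.
Proof.
rewrite (_ : wp = fun q => (1 - p q) * Om q); last exact/funext.
apply: measurable_funM => //; apply: measurable_funB => //.
exact: measurable_success_prob.
Qed.

Let measurable_wm : measurable_fun [set: Prompt] wm.
Proof.
rewrite (_ : wm = fun q => p q * Om q); last exact/funext.
by apply: measurable_funM => //; exact: measurable_success_prob.
Qed.

(** A uniform bound on the advantage: both weights are [Omega] times a number in [0, 1], and [Omega]
    is at most this. *)
Let M := (Num.sqrt eps)^-1.

Let Om_in q : 0 < Om q <= M.
Proof. by rewrite Omega_gt0 ?Omega_le ?success_prob_in. Qed.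

Let wp_in q : 0 <= wp q <= M.
Proof.
rewrite wpE; have /andP[lt0O OM] := Om_in q.
have /andP[p0 p1] := success_prob_in q.
rewrite mulr_ge0 ?subr_ge0 ?(ltW lt0O)//=; apply: le_trans OM.
by rewrite ler_piMl ?(ltW lt0O)// lerBlDr lerDl.
Qed.

Let wm_in q : 0 <= wm q <= M.
Proof.
rewrite wmE; have /andP[lt0O OM] := Om_in q.
have /andP[p0 p1] := success_prob_in q.
by rewrite mulr_ge0 ?(ltW lt0O)//=; apply: le_trans OM; rewrite ler_piMl ?(ltW lt0O).
Qed.

Let A := advantage mu r eps b.

Let AE q o : A q o = if r q o then wp q else - wm q.
Proof. by []. Qed.

Let A_le q o : `|A q o| <= M.
Proof.
rewrite AE; case: ifP => _; rewrite ?normrN ger0_norm.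
- by case/andP: (wp_in q).
- by case/andP: (wp_in q).
- by case/andP: (wm_in q).
- by case/andP: (wm_in q).
Qed.

Let measurable_A : measurable_fun [set: Prompt * Outcome] (fun x => A x.1 x.2).
Proof.
apply: measurable_fun_ifT => //.
  exact: (measurableT_comp measurable_wp).
by apply: measurableT_comp => //; exact: (measurableT_comp measurable_wm).
Qed.

(** The partition function of the tilt, in closed form because the advantage is two-valued. *)
Let Z q := p q * expR (wp q / beta) + (1 - p q) * expR (- wm q / beta).

(** [Z q] is a convex combination of exponentials whose exponents are at most [M / beta] in absolute
    value. This bounds [ln (Z q)], as [maximizer_ae_tilt] requires. *)
Let Z_in q : expR (- (M / beta)) <= Z q <= expR (M / beta).
Proof.
have /andP[p0 p1] := success_prob_in q.
have bound w : `|w| <= M ->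
    expR (- (M / beta)) <= expR (w / beta) <= expR (M / beta).
  rewrite ler_norml => /andP[w1 w2].
  by rewrite !ler_expR -mulNr !ler_wpM2r ?invr_ge0 ?(ltW beta_gt0).
have /andP[a1 a2] : expR (- (M / beta)) <= expR (wp q / beta) <= expR (M / beta).
  by apply: bound; rewrite ger0_norm; case/andP: (wp_in q).
have /andP[c1 c2] : expR (- (M / beta)) <= expR (- wm q / beta) <= expR (M / beta).
  by apply: bound; rewrite normrN ger0_norm; case/andP: (wm_in q).
rewrite /Z; apply/andP; split.
  rewrite (_ : expR (- (M / beta)) = p q * expR (- (M / beta)) +
    (1 - p q) * expR (- (M / beta))); last by ring.
  by rewrite lerD// ler_wpM2l// subr_ge0.
rewrite (_ : expR (M / beta) = p q * expR (M / beta) +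
  (1 - p q) * expR (M / beta)); last by ring.
by rewrite lerD// ler_wpM2l// subr_ge0.
Qed.

Let Z_gt0 q : 0 < Z q.
Proof. by have /andP[Z1 _] := Z_in q; rewrite (lt_le_trans (expR_gt0 _) Z1). Qed.

Let lnZ_le q : `|ln (Z q)| <= M / beta.
Proof.
have /andP[Z1 Z2] := Z_in q.
by rewrite ler_norml -ler_expR -[X in _ && X]ler_expR lnK ?posrE// Z1.
Qed.

Let measurable_lnZ : measurable_fun [set: Prompt] (fun q => ln (Z q)).
Proof.
apply: (measurableT_comp (@measurable_ln R)); apply: measurable_funD.
- apply: measurable_funM; first exact: measurable_success_prob.
  by apply: (measurableT_comp (@measurable_expR R)); exact: measurable_funM.
- apply: measurable_funM.
    by apply: measurable_funB => //; exact: measurable_success_prob.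
  apply: (measurableT_comp (@measurable_expR R)).
  by apply: measurable_funM => //; exact: measurableT_comp.
Qed.

Let tiltE q o : expR (A q o / beta - ln (Z q)) =
  if r q o then expR (wp q / beta) / Z q else expR (- wm q / beta) / Z q.
Proof. by rewrite AE expRD expRN lnK ?posrE//; case: ifP. Qed.

Let tilt1 q : (\int[mu]_o (b q o * expR (A q o / beta - ln (Z q)))%:E = 1)%E.
Proof.
under eq_integral do rewrite tiltE.
have [_ ->] := @policy_two_valued_integral q (expR (wp q / beta) / Z q)
  (expR (- wm q / beta) / Z q) (divr_ge0 (expR_ge0 _) (ltW (Z_gt0 q)))
  (divr_ge0 (expR_ge0 _) (ltW (Z_gt0 q))).
by congr EFin; rewrite !mulrA -mulrDl -/(Z q) divff// gt_eqF// Z_gt0.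
Qed.

(** On the success set the tilt is the constant factor [expR (wp q / beta) / Z q], so the new
    success probability is [p q] times that factor. Cancelling [expR (- wm q / beta)] from numerator
    and denominator turns it into [success_step]. *)
Lemma success_prob_GRPO_step f : is_mirror_GRPO_step rho mu r beta eps b f ->
  {ae rho, forall q, success_prob mu r f q = success_step eps beta (p q)}.
Proof.
case=> fpol fmax.
have := maximizer_ae_tilt beta_gt0 measurable_A A_le measurable_lnZ lnZ_le
  b_policy tilt1 fpol fmax.
apply: filterS => q fE.
have [mf f0 f1] := fpol; have [mb b0 b1] := b_policy.
have mfq := section_measurable q mf; have mbq := section_measurable q mb.
have mS : measurable [set o | r q o].
  by rewrite -[X in measurable X]setTI; exact: (section_measurable q r_meas).
have -> : success_prob mu r f q = p q * (expR (wp q / beta) / Z q).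
  rewrite /success_prob /Rintegral.
  rewrite (ae_eq_integral (fun o => (b q o)%:E * (expR (wp q / beta) / Z q)%:E)%E)//.
  - rewrite ge0_integralZr//.
    + rewrite fineM//; apply: integrable_fin_num => //.
      by apply: integrableS (density_integrable mbq (b0 q) (b1 q)).
    + by apply/measurable_EFinP; exact: measurable_funS mbq.
    + by move=> o _; rewrite lee_fin.
    + by rewrite lee_fin divr_ge0 ?expR_ge0 ?ltW.
  - by apply/measurable_EFinP; exact: measurable_funS mfq.
  - apply/measurable_EFinP; apply: (@measurable_funS _ _ _ _ setT) => //.
    exact: measurable_funM.
  - by apply: filterS fE => o -> /= ro; rewrite tiltE ro.
have pin := success_prob_in q; have /andP[p0 p1] := pin.
have E1 := expR_Omega_gt1 eps_gt0 beta_gt0 pin.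
have F0 := expR_gt0 (- wm q / beta).
(* Here the two weights combine: [wp q + wm q = Om q]. *)
have EF : expR (wp q / beta) = expR (Om q / beta) * expR (- wm q / beta).
  by rewrite -expRD wpE wmE; congr expR; ring.
rewrite /success_step /Z EF -/(Om q); rewrite -/(Om q) in E1.
move: (expR (Om q / beta)) (expR (- wm q / beta)) E1 F0 => E F E1 F0.
have D0 : 0 < p q * E + (1 - p q).
  rewrite (_ : _ + _ = 1 + p q * (E - 1)); last by ring.
  by rewrite ltr_wpDr ?mulr_ge0 ?subr_ge0 ?(ltW E1).
have Dn := lt0r_neq0 D0.
have -> : p q * (E * F) + (1 - p q) * F = F * (p q * E + (1 - p q)) by ring.
by field; rewrite (lt0r_neq0 F0) Dn.
Qed.

End step.

(** * Assembly of the theorem *)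

Unset Implicit Arguments.

Theorem theorem5 (R : realType) (dQ dO : measure_display)
    (Prompt : measurableType dQ) (Outcome : measurableType dO)
    (rho : probability Prompt R)
    (mu : {sigma_finite_measure set Outcome -> \bar R})
    (r : Prompt -> Outcome -> bool)
    (r_meas : measurable_fun [set: Prompt * Outcome] (fun x => r x.1 x.2))
    (beta eps : R) (beta_gt0 : 0 < beta) (eps_gt0 : 0 < eps) (eps_le1 : eps <= 1)
    (pi_ref : Prompt -> Outcome -> R) (pi_ref_policy : is_policy mu pi_ref)
    (pi_ : nat -> Prompt -> Outcome -> R)
    (pi_0 : pi_ 0%N = pi_ref)
    (pi_S : forall n : nat, (1 <= n)%N ->
       is_mirror_GRPO_step rho mu r beta eps (pi_ n.-1) (pi_ n)) :
  let p_ (n : nat) (q : Prompt) : R := success_prob mu r (pi_ n) q in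
  let p_ref (q : Prompt) : R := success_prob mu r pi_ref q in
  {ae rho, forall q : Prompt,
    ((forall n : nat, (1 <= n)%N -> 0 < p_ n.-1 q < 1 ->
        [/\ 0 < Omega eps (p_ n.-1 q) / beta,
            (logit (p_ n.-1 q) < logit (p_ n q))%E
          & p_ n.-1 q < p_ n q])
     /\ (~ exists p : R, 0 < p < 1 /\
           p = sigmoid (logit p + (Omega eps p / beta)%:E)%E)
     /\ (forall p : R, 0 <= p <= 1 ->
           (p = sigmoid (logit p + (Omega eps p / beta)%:E)%E <->
            p = 0 \/ p = 1)))
    /\ ((0 < p_ref q < 1 ->
           [/\ forall m n : nat, (m < n)%N -> p_ m q < p_ n q,
               forall n : nat, p_ n q <= 1
             & (p_ n q @[n --> \oo] --> (1 : R))])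
        /\ (0 < p_ref q < 1 ->
              (1 : R) = sigmoid (logit 1 + (Omega eps 1 / beta)%:E)%E
              /\ (p_ n q @[n --> \oo] --> (1 : R)))
        /\ (p_ref q = 0 -> forall n : nat, p_ n q = 0))}.
Proof.
move=> p_ p_ref.
have pol n : is_policy mu (pi_ n).
  by case: n => [|n]; [rewrite pi_0|case: (pi_S n.+1 isT)].
(* Each step holds off its own null set; a countable union of these is null, so a single exceptional
   set serves all [n]. *)
have : {ae rho, forall q, forall n, p_ n.+1 q = success_step eps beta (p_ n q)}.
  apply: ae_foralln => n.
  exact: (success_prob_GRPO_step r_meas beta_gt0 eps_gt0 (pol n) (pi_S n.+1 isT)).
apply: filterS => q pS.
have p_refE : p_ref q = p_ 0%N q by rewrite /p_ pi_0.
have fixed_iff (p : R) : 0 <= p <= 1 ->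
    (p = sigmoid (logit p + (Omega eps p / beta)%:E)%E <-> p = 0 \/ p = 1).
  (* Three cases: [p = 0] and [p = 1], where the conventions for infinite [logit] give fixed points,
     and the interior, where there are none. *)
  case/andP; rewrite !le_eqVlt => /predU1P[<- _|p0 /predU1P[->|p1]].
  - by rewrite sigmoid_logit_fixed0; split => // _; left.
  - by rewrite sigmoid_logit_fixed1; split => // _; right.
  - split=> [|[] pE]; last by move: p1; rewrite pE ltxx.
      by move=> pE; case: (@no_interior_fixed_point _ _ _ eps_gt0 beta_gt0 p);
        rewrite ?p0 ?p1.
    by move: p0; rewrite pE ltxx.
have step_in n := @success_step_in _ _ _ eps_gt0 beta_gt0 (p_ n q).
split; [split; [|split]|split; [|split]] => //.
(* With [n.+1] in place of [n] the predecessor reduces to [n]. The comparison of logits also uses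
   that the new probability stays below 1. *)
- move=> [//|n] _ /= pn01; have /andP[lt lt1] := step_in n pn01.
  have /andP[p0 p1] := pn01; rewrite pS; split => //.
  + by rewrite divr_gt0// Omega_gt0// !ltW.
  + exact: logit_lt.
- by case=> p [p01 /(no_interior_fixed_point eps_gt0 beta_gt0 p01)].
- rewrite p_refE => p01; split.
  + exact: (orbit_lt eps_gt0 beta_gt0 pS p01).
  + by move=> n; have /andP[_ /ltW] := orbit_in eps_gt0 beta_gt0 pS p01 n.
  + exact: (orbit_cvg1 eps_gt0 beta_gt0 pS p01 eps_le1).
- rewrite p_refE => p01; split; first by rewrite sigmoid_logit_fixed1.
  exact: (orbit_cvg1 eps_gt0 beta_gt0 pS p01 eps_le1).
- by rewrite p_refE => p0; exact: (orbit0 pS p0).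
Qed.
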